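(* Let $\{x_{ij}\}_{1\le i\le n,\,1\le j\le N}$ ($N\ge2$) be random variables that are independent across $i$ and, for each fixed $i$, i.i.d. across $j$. For a trivariate function $h(x;y,z)$ let $$H_{n,N}(x)=\frac{1}{nN(N-1)}\sum_{i=1}^n\sum_{1\le j\ne j'\le N}h(x;x_{ij},x_{ij'}).$$ Suppose there exist $b_i>0$ such that $\mathbb{E}\bigl[\int h^2(x;x_{i1},x_{i2})dx\bigr]\le b_i^2$ for each $1\le i\le n$. Let $\theta_i(x)=\mathbb{E}[h(x;x_{i1},x_{i2})]$ and $\theta(x)=n^{-1}\sum_{i=1}^n\theta_i(x)$. Then $$\mathbb{E}\Bigl[\int(H_{n,N}(x)-\theta(x))^2dx\Bigr]\le\frac{4(\sigma^2+b^2)}{nN},$$ where $\sigma^2=n^{-1}\sum_{i=1}^n\mathbb{E}\bigl[\int(h(x;x_{i1},x_{i2})-\theta_i(x))^2dx\bigr]$ and $b^2=n^{-1}\sum_{i=1}^nb_i^2$.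
   Context: Functions are (jointly) measurable. The inner sum is over ordered pairs $(j,j')$ with $j\ne j'$. *)

(* Defs.v *)
From HB Require Import structures.
From mathcomp Require Export all_boot all_order all_algebra.
From mathcomp Require Export all_classical all_reals all_analysis.

Set Implicit Arguments.
Unset Strict Implicit.
Unset Printing Implicit Defensive.

Import Order.TTheory GRing.Theory Num.Theory.

Local Open Scope classical_set_scope.
Local Open Scope ring_scope.

(* Mutual independence of a finite family of classes of events; the product
   rule is required on every subfamily. *)
Definition independent_classes (d : measure_display) (T : measurableType d)
    (R : realType) (P : probability T R) (I : finType)
    (G : I -> set (set T)) : Prop :=
  forall (J : {set I}) (A : I -> set T),
    (forall i, i \in J -> G i (A i)) ->
    P (\bigcap_(i in [set` J]) A i) = (\prod_(i in J) P (A i))%E.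

Definition independent_RVs (d : measure_display) (T : measurableType d)
    (R : realType) (P : probability T R) (I : finType)
    (X : I -> {RV P >-> R}) : Prop :=
  independent_classes P (fun i => g_sigma_algebra_preimage (X i)).

Definition sigma_RVs (d : measure_display) (T : measurableType d)
    (R : realType) (P : probability T R) (I : finType)
    (X : I -> {RV P >-> R}) : set (set T) :=
  <<s \bigcup_(i in [set: I]) g_sigma_algebra_preimage (X i) >>.

(* Independence of the random vectors (X i j)_j, with no condition inside a
   vector: the sigma-algebras they generate are independent. *)
Definition independent_rows (d : measure_display) (T : measurableType d)
    (R : realType) (P : probability T R) (I K : finType)
    (X : I -> K -> {RV P >-> R}) : Prop :=
  independent_classes P (fun i => sigma_RVs (X i)).

Definition identically_distributed (d : measure_display)
    (T : measurableType d) (R : realType) (P : probability T R) (I : finType)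
    (X : I -> {RV P >-> R}) : Prop :=
  forall (i j : I) (A : set R), measurable A ->
    distribution P (X i) A = distribution P (X j) A.

Definition iid (d : measure_display) (T : measurableType d) (R : realType)
    (P : probability T R) (I : finType) (X : I -> {RV P >-> R}) : Prop :=
  independent_RVs X /\ identically_distributed X.

(* The column indices 1 and 2, counted from 0 in 'I_N. *)
Definition idx1 (N : nat) (hN : (1 < N)%N) : 'I_N := Ordinal (ltnW hN).
Definition idx2 (N : nat) (hN : (1 < N)%N) : 'I_N := Ordinal hN.

Definition Hstat (d : measure_display) (T : measurableType d) (R : realType)
    (P : probability T R) (n N : nat) (X : 'I_n -> 'I_N -> {RV P >-> R})
    (h : R -> R -> R -> R) (x : R) (w : T) : R :=
  (n%:R * N%:R * (N%:R - 1))^-1 *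
  \sum_(i < n) \sum_(j < N) \sum_(k < N | j != k) h x (X i j w) (X i k w).

(* [fine] sends an infinite expectation to 0. Under
   E[\int h^2(x; x_i1, x_i2) dx] < +oo, the function h(x; x_i1, x_i2) is
   integrable for almost every x, so that this convention only matters on a
   Lebesgue-null set of x. *)
Definition theta_row (d : measure_display) (T : measurableType d)
    (R : realType) (P : probability T R) (n N : nat) (hN : (1 < N)%N)
    (X : 'I_n -> 'I_N -> {RV P >-> R}) (h : R -> R -> R -> R)
    (i : 'I_n) (x : R) : R :=
  fine ('E_P[fun w => h x (X i (idx1 hN) w) (X i (idx2 hN) w)])%E.

Definition theta (d : measure_display) (T : measurableType d) (R : realType)
    (P : probability T R) (n N : nat) (hN : (1 < N)%N)
    (X : 'I_n -> 'I_N -> {RV P >-> R}) (h : R -> R -> R -> R) (x : R) : R :=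
  n%:R^-1 * \sum_(i < n) theta_row hN X h i x.

(* ['E_P] only takes real-valued functions, whereas the inner integral may be
   infinite at some w; hence the outer [\int[P]]. *)
Definition sigma2 (d : measure_display) (T : measurableType d) (R : realType)
    (P : probability T R) (n N : nat) (hN : (1 < N)%N)
    (X : 'I_n -> 'I_N -> {RV P >-> R}) (h : R -> R -> R -> R) : \bar R :=
  ((n%:R^-1)%:E * \sum_(i < n)
     \int[P]_w \int[lebesgue_measure]_x
       ((h x (X i (idx1 hN) w) (X i (idx2 hN) w)
         - theta_row hN X h i x) ^+ 2)%:E)%E.

(* Main.v *)
Require Import Defs.
From HB Require Import structures.
From mathcomp Require Import all_boot all_order all_algebra.
From mathcomp Require Import all_classical all_reals all_analysis.
From mathcomp Require Import measurable_realfun ring lra.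

Set Implicit Arguments.
Unset Strict Implicit.
Unset Printing Implicit Defensive.

Import Order.TTheory GRing.Theory Num.Theory.

Local Open Scope classical_set_scope.
Local Open Scope ring_scope.

(* For a fixed x, put Y_ijk = h(x; x_ij, x_ik) - theta_i(x). If the variance
   v_i(x) of Y_i12 is infinite for some i, the pointwise bound is trivial, so
   assume that all are finite. Then E[Y_ijk Y_i'j'k'] vanishes unless i = i' and
   {j, k} meets {j', k'}, by independence, and is at most v_i(x) otherwise. Each
   (j, k) meets at most 4(N - 1) ordered pairs (j', k'), whence
     E[(H(x) - theta(x))^2]
       <= 4 N (N - 1)^2 / (n N (N - 1))^2 * sum_i v_i(x)
        = 4 / (n N) * (n^-1 sum_i v_i(x)),
   and it remains to integrate over x with Tonelli's theorem. *)

(** * Independence of two random elements and their joint law *)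

(** Dynkin's pi-lambda argument: measurable rectangles are stable under intersection and generate
    the product sigma-algebra, and the sets [C] obeying the product rule with [E] fixed form a
    Dynkin class. It extends independence from rectangles to all events on a pair. *)
Lemma indep_pair_event (d d1 d2 : measure_display) (T : measurableType d)
    (U1 : measurableType d1) (U2 : measurableType d2) (R : realType)
    (P : probability T R) (Z1 : {mfun T >-> U1}) (Z2 : {mfun T >-> U2})
    (E : set T) (mE : measurable E) :
    (forall A B, measurable A -> measurable B ->
      P (Z1 @^-1` A `&` Z2 @^-1` B `&` E) =
      P (Z1 @^-1` A `&` Z2 @^-1` B) * P E)%E ->
  forall C : set (U1 * U2), measurable C ->
    P ((fun w => (Z1 w, Z2 w)) @^-1` C `&` E) =
    (P ((fun w => (Z1 w, Z2 w)) @^-1` C) * P E)%E.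
Proof.
move=> indep C mC.
pose Z w := (Z1 w, Z2 w).
have mZ : measurable_fun setT Z by exact: measurable_fun_pair.
have mZC S : measurable S -> measurable (Z @^-1` S).
  by move=> mS; rewrite -[X in measurable X]setTI; exact: mZ.
pose G : set (set (U1 * U2)) :=
  [set A `*` B | A in measurable & B in measurable].
have GE : @measurable _ (U1 * U2)%type = <<s G >>.
  exact: measurable_prod_measurableType.
have sGC : <<s G >> C by rewrite -GE.
apply: (dynkin_induction (P := fun S => P (Z @^-1` S `&` E) =
  (P (Z @^-1` S) * P E)%E) GE _ _ _ _ _ sGC).
- move=> _ _ [A mA [B mB <-]] [A' mA' [B' mB' <-]].
  exists (A `&` A'); first exact: measurableI.
  exists (B `&` B'); first exact: measurableI.
  by rewrite setXI.
- by rewrite preimage_setT setTI probability_setT mul1e.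
- by move=> _ [A mA [B mB <-]]; exact: indep.
- move=> S mS IH; have mZS := mZC _ mS.
  have -> : P (Z @^-1` (~` S) `&` E) = (P E - P (Z @^-1` S `&` E))%E.
    rewrite (setIC (Z @^-1` S)) -measureD ?ltey_eq ?fin_num_measure//.
    by rewrite setDE setIC.
  rewrite preimage_setC probability_setC// IH muleBl ?fin_num_measure ?mul1e//.
- move=> F mF tF IH; rewrite preimage_bigcup setI_bigcupl.
  have tZ : trivIset setT (fun k => Z @^-1` F k).
    apply/trivIsetP => i j _ _ ij; rewrite -preimage_setI.
    by move/trivIsetP : tF => -> //; rewrite preimage_set0.
  rewrite measure_bigcup//=; last 2 first.
  + by move=> k _; apply: measurableI => //; exact: (mZC _ (mF k)).
  + exact: trivIset_setIr.
  rewrite measure_bigcup//=; last by move=> k _; exact: (mZC _ (mF k)).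
  rewrite -[in RHS](fineK (fin_num_measure P _ mE)) muleC.
  rewrite -nneseriesZl//.
  apply: eq_eseriesr => k _.
  by rewrite IH fineK ?fin_num_measure// muleC.
Qed.

(** The codomains are arbitrary measurable spaces, so that the notion covers real variables as well
    as pairs of entries with values in [R * R]. *)
Definition indep2 (d d1 d2 : measure_display) (T : measurableType d)
    (U1 : measurableType d1) (U2 : measurableType d2) (R : realType)
    (P : probability T R) (Z1 : T -> U1) (Z2 : T -> U2) : Prop :=
  forall A B, measurable A -> measurable B ->
    P (Z1 @^-1` A `&` Z2 @^-1` B) = (P (Z1 @^-1` A) * P (Z2 @^-1` B))%E.

(** On rectangles, the law of [(Z1, Z2)] is the product of the two laws, so uniqueness of the
    product measure identifies them; the rest is change of variables, which asks for an integrable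
    or a nonnegative integrand. *)
Lemma integral_indep2 (d d1 d2 : measure_display) (T : measurableType d)
    (U1 : measurableType d1) (U2 : measurableType d2) (R : realType)
    (P : probability T R) (Z1 : {mfun T >-> U1}) (Z2 : {mfun T >-> U2})
    (f : U1 * U2 -> \bar R) :
    indep2 P Z1 Z2 -> measurable_fun setT f ->
    P.-integrable setT (fun w => f (Z1 w, Z2 w)) \/ (forall u, 0 <= f u)%E ->
  (\int[P]_w f (Z1 w, Z2 w) =
   \int[distribution P Z1 \x distribution P Z2]_u f u)%E.
Proof.
move=> Z12 mf intf.
have mZ : measurable_fun setT (fun w => (Z1 w, Z2 w)).
  exact: measurable_fun_pair.
pose Z : {mfun T >-> (U1 * U2)%type} :=
  HB.pack (fun w => (Z1 w, Z2 w)) (isMeasurableFun.Build _ _ _ _ _ mZ).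
have lawE S : measurable S ->
    (distribution P Z1 \x distribution P Z2)%E S = distribution P Z S.
  by apply: product_measure_unique => A B mA mB; exact: Z12.
transitivity (\int[distribution P Z]_u f u)%E.
  case: intf => [intf|f0].
    by rewrite integral_distribution.
  by rewrite ge0_integral_distribution.
by apply: eq_measure_integral => A mA _; exact: esym (lawE A mA).
Qed.

Lemma indep2_comp (d d1 d2 e1 e2 : measure_display) (T : measurableType d)
    (U1 : measurableType d1) (U2 : measurableType d2)
    (V1 : measurableType e1) (V2 : measurableType e2) (R : realType)
    (P : probability T R) (Z1 : T -> U1) (Z2 : T -> U2)
    (f1 : {mfun U1 >-> V1}) (f2 : {mfun U2 >-> V2}) :
  indep2 P Z1 Z2 -> indep2 P (f1 \o Z1) (f2 \o Z2).
Proof.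
move=> Z12 A B mA mB; apply: (Z12 (f1 @^-1` A) (f2 @^-1` B)).
  exact: measurable_funPTI.
exact: measurable_funPTI.
Qed.

(** Fubini under the product law; square-integrability makes both factors and their product
    integrable. *)
Lemma indep2_integralM (d : measure_display) (T : measurableType d)
    (R : realType) (P : probability T R) (Y1 Y2 : {mfun T >-> R}) :
    indep2 P Y1 Y2 ->
    (Y1 : T -> R) \in Lfun P 2%:E -> (Y2 : T -> R) \in Lfun P 2%:E ->
  (\int[P]_w (Y1 w * Y2 w)%:E =
   (\int[P]_w (Y1 w)%:E) * (\int[P]_w (Y2 w)%:E))%E.
Proof.
move=> Y12 Y1L2 Y2L2.
have PT : P setT \is a fin_num by exact: fin_num_measure.
have /Lfun1_integrable Y1i := Lfun_subset12 PT Y1L2.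
have /Lfun1_integrable Y2i := Lfun_subset12 PT Y2L2.
have /Lfun1_integrable Y12i := Lfun2_mul_Lfun1 Y1L2 Y2L2.
pose f (u : R * R) : \bar R := (u.1 * u.2)%:E.
have mf : measurable_fun setT f.
  by apply/measurable_EFinP; exact: measurable_funM.
have i1 : (distribution P Y1).-integrable setT EFin.
  by apply: integrable_pushforward => //; exact: measurable_funP.
have i2 : (distribution P Y2).-integrable setT EFin.
  by apply: integrable_pushforward => //; exact: measurable_funP.
have e1 : (\int[distribution P Y1]_u u%:E = \int[P]_w (Y1 w)%:E)%E.
  by rewrite integral_distribution.
have e2 : (\int[distribution P Y2]_u u%:E = \int[P]_w (Y2 w)%:E)%E.
  by rewrite integral_distribution.
have fi : (distribution P Y1 \x distribution P Y2)%E.-integrable setT f.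
  apply/integrableP; split => //.
  (* The nonnegative form, applied to [|f|], carries the integrability of [Y1 * Y2] over to [f]
     under the product law. *)
  rewrite -(integral_indep2 (f := fun u => `|f u|%E) Y12); last 2 first.
  - exact: measurableT_comp.
  - by right.
  by case/integrableP : Y12i.
rewrite (integral_indep2 (f := f) Y12 mf); last by left.
rewrite -integral12_prod_meas1// /fubini_F /f /=.
under eq_integral do under eq_integral do rewrite EFinM.
under eq_integral do rewrite integralZl//.
have e2f : (\int[P]_w (Y2 w)%:E)%E \is a fin_num by exact: integrable_fin_num.
by rewrite e2 -(fineK e2f) integralZr// e1.
Qed.

(** * Pairs of entries of the array: independence and equality in law *)

Section pair_of_random_variables.
Context (d d1 d2 : measure_display) (T : measurableType d).
Context (U1 : measurableType d1) (U2 : measurableType d2).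

(** Named so that the structure of measurable function can be attached to it and inferred in later
    uses. *)
Definition mpair (Z1 : {mfun T >-> U1}) (Z2 : {mfun T >-> U2}) (w : T) :
  U1 * U2 := (Z1 w, Z2 w).

Lemma measurable_mpair (Z1 : {mfun T >-> U1}) (Z2 : {mfun T >-> U2}) :
  measurable_fun setT (mpair Z1 Z2).
Proof. exact: measurable_fun_pair. Qed.

HB.instance Definition _ (Z1 : {mfun T >-> U1}) (Z2 : {mfun T >-> U2}) :=
  isMeasurableFun.Build _ _ _ _ (mpair Z1 Z2) (measurable_mpair Z1 Z2).

End pair_of_random_variables.

Section independence_of_pairs.
Context (d : measure_display) (T : measurableType d) (R : realType).
Context (P : probability T R) (I : finType).

(** Restates the product rule along a duplicate-free list, so that explicit lists of two or four
    indices can be unfolded term by term. *)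
Lemma independent_RVs_seq (X : I -> {RV P >-> R}) (s : seq I) (B : I -> set R) :
    independent_RVs X -> uniq s -> (forall i, measurable (B i)) ->
  (P (\big[setI/setT]_(i <- s) (X i @^-1` B i)) =
   \prod_(i <- s) P (X i @^-1` B i))%E.
Proof.
move=> Xindep us mB.
pose J := [set i in s]%SET.
have -> : (\prod_(i <- s) P (X i @^-1` B i) =
           \prod_(i in J) P (X i @^-1` B i))%E.
  by rewrite big_uniq//; apply: eq_bigl => i; rewrite inE.
rewrite -(Xindep J (fun i => X i @^-1` B i)); last first.
  by move=> i _; exists (B i) => //; rewrite setTI.
rewrite -bigcap_seq; congr (P (\bigcap_(i in _) _)).
by apply/seteqP; split => i /=; rewrite inE.
Qed.

Lemma independent_RVs_indep2 (X : I -> {RV P >-> R}) (j k : I) :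
  independent_RVs X -> j != k -> indep2 P (X j) (X k).
Proof.
move=> Xindep jk A B mA mB.
have us : uniq [:: j; k] by rewrite /= inE jk.
pose C i := if i == j then A else B.
have mC i : measurable (C i) by rewrite /C; case: ifP.
have := independent_RVs_seq Xindep us mC.
by rewrite !big_cons !big_nil setIT mule1 /C eqxx eq_sym (negbTE jk).
Qed.

(** The product rule for four distinct indices settles rectangles in both pairs; [indep_pair_event]
    then extends it to arbitrary events, one pair at a time. *)
Lemma independent_RVs_indep2_pairs (X : I -> {RV P >-> R}) (j k j' k' : I) :
    independent_RVs X -> uniq [:: j; k; j'; k'] ->
  indep2 P (mpair (X j) (X k)) (mpair (X j') (X k')).
Proof.
move=> Xindep us.
have Xjk : indep2 P (X j) (X k).
  apply: independent_RVs_indep2 => //.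
  by move: us; rewrite /= !inE !negb_or => /andP[/and3P[]].
have Xj'k' : indep2 P (X j') (X k').
  apply: independent_RVs_indep2 => //.
  by move: us; rewrite /= !inE => /and4P[].
have four A B A' B' : measurable A -> measurable B ->
    measurable A' -> measurable B' ->
    P (X j @^-1` A `&` X k @^-1` B `&` (X j' @^-1` A' `&` X k' @^-1` B')) =
    (P (X j @^-1` A `&` X k @^-1` B) * P (X j' @^-1` A' `&` X k' @^-1` B'))%E.
  move=> mA mB mA' mB'.
  rewrite Xjk// Xj'k'//.
  pose C i := if i == j then A else if i == k then B else
    if i == j' then A' else B'.
  have mC i : measurable (C i) by rewrite /C; do 3 ![case: ifP => // _].
  have := independent_RVs_seq Xindep us mC.
  move: us; rewrite /= !inE !negb_or.
  move=> /and4P[/and3P[jk jj' jk'] /andP[kj' kk'] j'k' _].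
  rewrite !big_cons !big_nil setIT mule1 /C.
  rewrite !eqxx !(eq_sym k) !(eq_sym j') !(eq_sym k').
  rewrite (negbTE jk) (negbTE jj') (negbTE jk') (negbTE kj') (negbTE kk').
  by rewrite (negbTE j'k') setIA muleA.
have mpre (Y : {RV P >-> R}) A : measurable A -> measurable (Y @^-1` A).
  exact: measurable_funPTI.
move=> C D mC mD; rewrite setIC muleC.
(* With the event of the first pair held fixed, [D] is reduced to a rectangle; then, with that
   rectangle held fixed, [C] is reduced in the same way. *)
apply: (@indep_pair_event _ _ _ _ _ _ _ P (X j') (X k')) => //.
  exact: measurable_funPTI.
move=> A' B' mA' mB'; rewrite setIC muleC.
apply: (@indep_pair_event _ _ _ _ _ _ _ P (X j) (X k)) => //.
  by apply: measurableI; exact: mpre.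
by move=> A B mA mB; exact: four.
Qed.

(** The sets whose preimage under the pair lies in [sigma_RVs X] form a sigma-algebra, and it
    contains the preimages under the two projections, which generate the product sigma-algebra. *)
Lemma sigma_RVs_pair (K : finType) (X : K -> {RV P >-> R}) (j k : K)
    (C : set (R * R)) :
  measurable C -> sigma_RVs X (mpair (X j) (X k) @^-1` C).
Proof.
move=> mC; pose Z := mpair (X j) (X k).
have sX : sigma_algebra setT (sigma_RVs X) by exact: smallest_sigma_algebra.
have sub l (A : set R) : measurable A -> sigma_RVs X (X l @^-1` A).
  move=> mA; apply: sub_sigma_algebra.
  by exists l => //; exists A => //; rewrite setTI.
suff : measurable `<=` image_set_system setT Z (sigma_RVs X).
  by move=> /(_ _ mC); rewrite /image_set_system /= setTI.
apply: smallest_sub; first exact: sigma_algebra_image.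
move=> _ [[A mA <-]|[A mA <-]]; rewrite /image_set_system /= !setTI.
  exact: (sub j).
exact: (sub k).
Qed.

(** Each event lies in the sigma-algebra of its own row by [sigma_RVs_pair], so the product rule for
    the rows [i] and [i'] applies directly. *)
Lemma independent_rows_indep2_pairs (K : finType) (X : I -> K -> {RV P >-> R})
    (i i' : I) (j k j' k' : K) :
    independent_rows X -> i != i' ->
  indep2 P (mpair (X i j) (X i k)) (mpair (X i' j') (X i' k')).
Proof.
move=> Xindep ii' C D mC mD.
pose A l := if l == i then mpair (X i j) (X i k) @^-1` C
            else mpair (X i' j') (X i' k') @^-1` D.
have := Xindep [set i; i']%SET A.
rewrite big_setU1 ?inE//= big_set1 /A eqxx eq_sym (negbTE ii') => <-.
  congr (P _); apply/seteqP; split => w /=.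
    by move=> [wC wD] l /=; case: ifP.
  move=> h; split.
    by have := h i; rewrite /= !inE eqxx; exact.
  by have := h i'; rewrite /= !inE eqxx orbT eq_sym (negbTE ii'); exact.
move=> l; rewrite !inE; case: eqP => [-> _|_ /= /eqP ->].
  exact: sigma_RVs_pair.
exact: sigma_RVs_pair.
Qed.

(** Both pairs have as law the square of the common marginal. Treating the positive and negative
    parts of [f] separately gives the equality without integrability. *)
Lemma iid_integral_pair (X : I -> {RV P >-> R}) (j k j' k' : I)
    (f : R * R -> \bar R) :
    iid X -> j != k -> j' != k' -> measurable_fun setT f ->
  (\int[P]_w f (X j w, X k w) = \int[P]_w f (X j' w, X k' w))%E.
Proof.
move=> [Xindep Xid] jk j'k' mf.
have ge0 (g : R * R -> \bar R) :
    measurable_fun setT g -> (forall u, 0 <= g u)%E ->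
    (\int[P]_w g (X j w, X k w) = \int[P]_w g (X j' w, X k' w))%E.
  move=> mg g0.
  rewrite !integral_indep2//; try by [right|exact: independent_RVs_indep2].
  apply: eq_measure_integral => C mC _.
  apply: product_measure_unique => // A B mA mB.
  etransitivity; first exact: product_measure1E.
  by congr (_ * _)%E; [exact: Xid j' j A mA|exact: Xid k' k B mB].
rewrite integralE [RHS]integralE; congr (_ - _)%E.
  rewrite (funepos_comp f (mpair (X j) (X k))).
  rewrite (funepos_comp f (mpair (X j') (X k'))).
  by apply: (ge0 f^\+%E) => //; exact: measurable_funepos.
rewrite (funeneg_comp f (mpair (X j) (X k))).
rewrite (funeneg_comp f (mpair (X j') (X k'))).
by apply: (ge0 f^\-%E) => //; exact: measurable_funeneg.
Qed.

End independence_of_pairs.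

(** * Square-integrability, pair counting and second moments of finite sums *)

Lemma sqr_integral_lty_Lfun2 (d : measure_display) (T : measurableType d)
    (R : realType) (mu : {measure set T -> \bar R}) (f : T -> R) :
    measurable_fun setT f -> (\int[mu]_w ((f w) ^+ 2)%:E < +oo)%E ->
  f \in Lfun mu 2%:E.
Proof.
move=> mf f2; rewrite inE; apply/andP; split; rewrite inE//=.
rewrite /finite_norm unlock /=.
apply: poweR_lty; rewrite (le_lt_trans _ f2)//.
under eq_integral => x _ do rewrite powR_mulrn// -normrX ger0_norm ?sqr_ge0//.
by [].
Qed.

Section pair_counting.
Context (R : realType) (N : nat).

Lemma sum_distinct_const (c : R) :
  \sum_(j < N) \sum_(k < N | j != k) c = N%:R * N.-1%:R * c.
Proof.
under eq_bigr => j _.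
  rewrite sumr_const (_ : #|_| = N.-1); last first.
    rewrite -[in RHS](card_ord N) -(cardC1 j).
    by apply: eq_card => k; rewrite !inE eq_sym.
  over.
by rewrite sumr_const card_ord -mulrA !mulr_natl.
Qed.

Lemma sum_distinct_eql (i : 'I_N) :
  \sum_(j < N) \sum_(k < N | j != k) (i == j)%:R = N.-1%:R :> R.
Proof.
rewrite (bigD1 i)//= [X in _ + X]big1 ?addr0; last first.
  by move=> j ji; apply: big1 => k _; rewrite eq_sym (negbTE ji).
rewrite eqxx sumr_const; congr (_%:R).
rewrite -[in RHS](card_ord N) -(cardC1 i).
by apply: eq_card => k; rewrite !inE eq_sym.
Qed.

Lemma sum_distinct_eqr (i : 'I_N) :
  \sum_(j < N) \sum_(k < N | j != k) (i == k)%:R = N.-1%:R :> R.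
Proof.
rewrite -(sum_distinct_eql i) (exchange_big_dep predT)//=.
by apply: eq_bigr => j _; apply: eq_bigl => k; rewrite eq_sym.
Qed.

End pair_counting.

Lemma integral_sqr_sum (d : measure_display) (T : measurableType d)
    (R : realType) (mu : {measure set T -> \bar R}) (A : finType)
    (Q : pred A) (Y : A -> T -> R) :
    (forall a, Q a -> Y a \in Lfun mu 2%:E) ->
  (\int[mu]_w ((\sum_(a | Q a) Y a w) ^+ 2)%:E =
   \sum_(a | Q a) \sum_(b | Q b) \int[mu]_w (Y a w * Y b w)%:E)%E.
Proof.
move=> YL2.
have YY a b : Q a -> Q b -> mu.-integrable setT (fun w => (Y a w * Y b w)%:E).
  by move=> Qa Qb; exact/Lfun1_integrable/Lfun2_mul_Lfun1/YL2/Qb/YL2.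
transitivity (\int[mu]_w (\sum_(a | Q a) \sum_(b | Q b) (Y a w * Y b w)%:E))%E.
  apply: eq_integral => w _; rewrite expr2 big_distrlr/= -sumEFin.
  by apply: eq_bigr => a _; rewrite -sumEFin.
(* Extending the terms by 0 outside [Q] makes all of them integrable, as the interchange of sum and
   integral requires. *)
pose f a b w := if Q a && Q b then (Y a w * Y b w)%:E else 0%E.
have fi a b : mu.-integrable setT (f a b).
  rewrite /f; case: (boolP (Q a && Q b)) => [/andP[Qa Qb]|_]; first exact: YY.
  exact: integrable0.
transitivity (\int[mu]_w (\sum_(a | Q a) \sum_(b | Q b) f a b w))%E.
  apply: eq_integral => w _; apply: eq_bigr => a Qa; apply: eq_bigr => b Qb.
  by rewrite /f Qa Qb.
rewrite integral_sum//; last first.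
  by move=> a; apply: integrable_sum => // b _; exact: fi.
apply: eq_bigr => a Qa; rewrite integral_sum//; apply: eq_bigr => b Qb.
by rewrite /f Qa Qb.
Qed.

(** Pointwise, a product is at most the mean of the two squares, and here both squares integrate to
    [v]. *)
Lemma integralM_le (d : measure_display) (T : measurableType d) (R : realType)
    (P : probability T R) (Y1 Y2 : T -> R) (v : R) :
    Y1 \in Lfun P 2%:E -> Y2 \in Lfun P 2%:E ->
    (\int[P]_w ((Y1 w) ^+ 2)%:E = v%:E)%E ->
    (\int[P]_w ((Y2 w) ^+ 2)%:E = v%:E)%E ->
  (\int[P]_w (Y1 w * Y2 w)%:E <= v%:E)%E.
Proof.
move=> Y1L2 Y2L2 Y1v Y2v.
have i12 := Lfun2_mul_Lfun1 Y1L2 Y2L2.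
have i11 := Lfun2_integrable_sqr Y1L2.
have i22 := Lfun2_integrable_sqr Y2L2.
have -> : v%:E = ((2^-1)%:E * (\int[P]_w ((Y1 w) ^+ 2)%:E
                              + \int[P]_w ((Y2 w) ^+ 2)%:E))%E.
  by rewrite Y1v Y2v -EFinD -EFinM; congr (_%:E); field.
rewrite -integralD// -integralZl//=; last exact: integrableD.
apply: le_integral => //.
- exact/Lfun1_integrable.
- by apply: integrableZl => //; exact: integrableD.
- move=> w _ /=; rewrite -EFinD -EFinM lee_fin.
  have := sqr_ge0 (Y1 w - Y2 w); nra.
Qed.

(** * Second moment of the centred triple sum *)

Section centered_ustatistic.
Context (d : measure_display) (T : measurableType d) (R : realType).
Context (P : probability T R) (n N : nat) (hN : (1 < N)%N).
Variable X : 'I_n -> 'I_N -> {RV P >-> R}.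
Variable F : 'I_n -> {mfun (R * R)%type >-> R}.
Variable V : 'I_n -> R.
Hypothesis X_rows : independent_rows X.
Hypothesis X_iid : forall i, iid (X i).
Hypothesis F2 : forall i,
  (\int[P]_w ((F i (X i (idx1 hN) w, X i (idx2 hN) w)) ^+ 2)%:E = (V i)%:E)%E.
Hypothesis F0 : forall i,
  (\int[P]_w (F i (X i (idx1 hN) w, X i (idx2 hN) w))%:E = 0)%E.

Let Y i j k : T -> R := F i \o mpair (X i j) (X i k).

(** The moments are given for the first two columns only; [iid_integral_pair] carries them to every
    pair of distinct columns, here and in [mean]. *)
Let sqr i j k : j != k -> (\int[P]_w ((Y i j k w) ^+ 2)%:E = (V i)%:E)%E.
Proof.
move=> jk; rewrite -F2.
apply: (iid_integral_pair (f := fun u => ((F i u) ^+ 2)%:E)) => //.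
by apply/measurable_EFinP; exact: measurable_funX.
Qed.

Let mean i j k : j != k -> (\int[P]_w (Y i j k w)%:E = 0)%E.
Proof.
move=> jk; rewrite -(F0 i).
apply: (iid_integral_pair (f := fun u => (F i u)%:E)) => //.
exact/measurable_EFinP.
Qed.

Let YL2 i j k : j != k -> Y i j k \in Lfun P 2%:E.
Proof.
move=> jk; apply: sqr_integral_lty_Lfun2; last by rewrite sqr// ltry.
exact: measurableT_comp.
Qed.

Let V_ge0 i : 0 <= V i.
Proof.
by rewrite -lee_fin -F2; apply: integral_ge0 => w _; rewrite lee_fin sqr_ge0.
Qed.

(* The number of coincidences between (j, k) and (j', k'): it dominates the
   indicator that the two pairs meet, and is easy to sum. *)
Let overlap (j k j' k' : 'I_N) : R :=
  (j == j')%:R + (j == k')%:R + (k == j')%:R + (k == k')%:R.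

Let orthogonal i j k i' j' k' : j != k -> j' != k' ->
  indep2 P (mpair (X i j) (X i k)) (mpair (X i' j') (X i' k')) ->
  (\int[P]_w (Y i j k w * Y i' j' k' w)%:E = 0)%E.
Proof.
move=> jk j'k' /(@indep2_comp _ _ _ _ _ _ _ _ _ _ _ _ _ _ (F i) (F i')) ind.
rewrite (indep2_integralM ind) ?YL2//.
by rewrite [X in (X * _)%E](mean _ jk)// mul0e.
Qed.

Let cov i j k i' j' k' : j != k -> j' != k' ->
  (\int[P]_w (Y i j k w * Y i' j' k' w)%:E <=
   ((i == i')%:R * overlap j k j' k' * V i)%:E)%E.
Proof.
move=> jk j'k'; have [<-|ii'] := eqVneq i i'; last first.
  rewrite orthogonal ?mul0r//; exact: independent_rows_indep2_pairs.
rewrite mul1r.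
have [us|] := boolP (uniq [:: j; k; j'; k']).
  rewrite orthogonal// ?lee_fin.
    by rewrite mulr_ge0// /overlap !addr_ge0.
  by apply: independent_RVs_indep2_pairs => //; case: (X_iid i).
(* Since [j != k] and [j' != k'], a repetition among the four indices must be a coincidence between
   the two pairs. *)
rewrite /= !inE (negbTE jk) (negbTE j'k') /= => nus.
have ov : 1 <= overlap j k j' k'.
  move: nus; rewrite /overlap.
  by do 4 ![case: eqP => //= _]; move=> _; rewrite ?add0r ?addr0; lra.
have := integralM_le (YL2 i jk) (YL2 i j'k') (sqr i jk) (sqr i j'k').
move/le_trans; apply.
by rewrite lee_fin ler_peMl.
Qed.

(** Each of the four coincidences fixes one coordinate of [(j', k')] and leaves [N - 1] choices for
    the other. This is the source of the constant 4 in the theorem. *)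
Let sum_overlap j k :
  \sum_(j' < N) \sum_(k' < N | j' != k') overlap j k j' k' = 4 * N.-1%:R.
Proof.
under eq_bigr do rewrite !big_split/=.
rewrite !big_split/= !sum_distinct_eql !sum_distinct_eqr.
by ring.
Qed.

Lemma centered_ustatistic_sqr_le :
  (\int[P]_w ((\sum_(i < n) \sum_(j < N) \sum_(k < N | j != k)
     F i (X i j w, X i k w)) ^+ 2)%:E <=
   (4 * N%:R * N.-1%:R ^+ 2 * \sum_(i < n) V i)%:E)%E.
Proof.
(* Flattening the triple sum into one sum over a finite type lets [integral_sqr_sum] expand the
   square. *)
pose A : finType := ('I_n * ('I_N * 'I_N))%type.
pose Q (a : A) := a.2.1 != a.2.2.
pose Z (a : A) := Y a.1 a.2.1 a.2.2.
have sumE (f : 'I_n -> 'I_N -> 'I_N -> R) :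
    \sum_(i < n) \sum_(j < N) \sum_(k < N | j != k) f i j k =
    \sum_(a : A | Q a) f a.1 a.2.1 a.2.2.
  under eq_bigr do rewrite pair_big_dep/=.
  by rewrite pair_big_dep/=; apply: eq_bigl.
under eq_integral do rewrite sumE.
rewrite (@integral_sqr_sum _ _ _ _ A Q Z); last by move=> a; exact: YL2.
apply: (@le_trans _ _ (\sum_(a | Q a) \sum_(b | Q b)
   ((a.1 == b.1)%:R * overlap a.2.1 a.2.2 b.2.1 b.2.2 * V a.1)%:E)%E).
  by apply: lee_sum => a Qa; apply: lee_sum => b Qb; exact: cov.
under eq_bigr do rewrite sumEFin.
rewrite sumEFin lee_fin.
(* For fixed [a], only the row [a.1] survives in the sum over [b], and [sum_overlap] evaluates what
   remains. *)
under eq_bigr => a _.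
  rewrite -(sumE (fun i j k =>
    (a.1 == i)%:R * overlap a.2.1 a.2.2 j k * V a.1)).
  rewrite (bigD1 a.1)//= [X in _ + X]big1 ?addr0; last first.
    move=> i ia; apply: big1 => j _; apply: big1 => k _.
    by rewrite eq_sym (negbTE ia) !mul0r.
  rewrite eqxx.
  under eq_bigr do under eq_bigr do rewrite mul1r.
  under eq_bigr do rewrite -mulr_suml.
  rewrite -mulr_suml sum_overlap.
  over.
rewrite -(sumE (fun i _ _ => 4 * N.-1%:R * V i)).
under eq_bigr do rewrite sum_distinct_const.
by rewrite -!mulr_sumr le_eqVlt; apply/orP; left; apply/eqP; ring.
Qed.

End centered_ustatistic.

(** * The bound for a fixed x *)

Lemma Hstat_sub_theta (d : measure_display) (T : measurableType d)
    (R : realType) (P : probability T R) (n N : nat) (hn : (0 < n)%N)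
    (hN : (1 < N)%N) (X : 'I_n -> 'I_N -> {RV P >-> R})
    (h : R -> R -> R -> R) (x : R) (w : T) :
  Hstat X h x w - theta hN X h x =
  (n%:R * N%:R * N.-1%:R)^-1 * \sum_(i < n) \sum_(j < N) \sum_(k < N | j != k)
    (h x (X i j w) (X i k w) - theta_row hN X h i x).
Proof.
(* [Hstat] subtracts 1 in [R], whereas counting produces the natural predecessor; the two agree
   because [N] is positive. *)
have N1 : N%:R - 1 = N.-1%:R :> R by rewrite -subn1 natrB// ltnW.
under [in RHS]eq_bigr do under eq_bigr do rewrite big_split/=.
under [in RHS]eq_bigr do rewrite big_split/=.
under [in RHS]eq_bigr do rewrite sum_distinct_const mulrN.
rewrite sumrB -mulr_sumr mulrBr /Hstat /theta N1; congr (_ - _).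
rewrite mulrA; congr (_ * _).
have n0 : n%:R != 0 :> R by rewrite pnatr_eq0 -lt0n.
have N0 : N%:R != 0 :> R by rewrite pnatr_eq0 -lt0n ltnW.
have N10 : N.-1%:R != 0 :> R by rewrite pnatr_eq0 -lt0n -subn1 subn_gt0.
by field; rewrite n0 N0 N10.
Qed.

Lemma integral_Hstat_sub_theta_sqr_le (d : measure_display)
    (T : measurableType d) (R : realType) (P : probability T R) (n N : nat)
    (hn : (0 < n)%N) (hN : (1 < N)%N) (X : 'I_n -> 'I_N -> {RV P >-> R})
    (X_rows : independent_rows X) (X_iid : forall i, iid (X i))
    (h : R -> R -> R -> R) (x : R)
    (hx_meas : measurable_fun [set: R * R] (fun u : R * R => h x u.1 u.2)) :
  (\int[P]_w ((Hstat X h x w - theta hN X h x) ^+ 2)%:E <=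
   (4 / (n%:R * N%:R))%:E * ((n%:R^-1)%:E * \sum_(i < n)
     \int[P]_w ((h x (X i (idx1 hN) w) (X i (idx2 hN) w)
                 - theta_row hN X h i x) ^+ 2)%:E))%E.
Proof.
set v := fun i => (\int[P]_w ((h x (X i (idx1 hN) w) (X i (idx2 hN) w)
                 - theta_row hN X h i x) ^+ 2)%:E)%E.
have v_ge0 i : (0 <= v i)%E.
  by apply: integral_ge0 => w _; rewrite lee_fin sqr_ge0.
have n_gt0 : 0 < n%:R :> R by rewrite ltr0n.
have N_gt0 : 0 < N%:R :> R by rewrite ltr0n ltnW.
have N1_gt0 : 0 < N.-1%:R :> R by rewrite ltr0n -subn1 subn_gt0.
(* If this sum is infinite, then so is the right-hand side. If it is finite,
   then h(x; x_i1, x_i2) is integrable and [fine] in theta_row is harmless. *)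
have [vy|] := ltP (\sum_(i < n) v i)%E +oo%E; last first.
  rewrite leye_eq => /eqP ->.
  rewrite gt0_muley ?lte_fin ?invr_gt0//.
  by rewrite gt0_muley ?leey// lte_fin divr_gt0 ?mulr_gt0.
have v_fin i : v i \is a fin_num.
  rewrite ge0_fin_numE// (le_lt_trans _ vy)// (bigD1 i)//= leeDl//.
  exact: sume_ge0.
have mF i : measurable_fun [set: R * R]
    (fun u : R * R => h x u.1 u.2 - theta_row hN X h i x).
  exact: measurable_funB.
pose F i : {mfun (R * R)%type >-> R} :=
  HB.pack (fun u : R * R => h x u.1 u.2 - theta_row hN X h i x)
          (isMeasurableFun.Build _ _ _ _ _ (mF i)).
have F2 i : (\int[P]_w ((F i (X i (idx1 hN) w, X i (idx2 hN) w)) ^+ 2)%:E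
             = (fine (v i))%:E)%E by rewrite fineK.
have F0 i : (\int[P]_w (F i (X i (idx1 hN) w, X i (idx2 hN) w))%:E = 0)%E.
  have PT : P setT \is a fin_num by exact: fin_num_measure.
  (* The centred function is in L^2, hence in L^1, whatever constant was subtracted. Adding the
     constant back puts [h] itself in L^1, so [theta_row] is its true expectation and the centred
     mean vanishes. *)
  have FL1 : F i \o mpair (X i (idx1 hN)) (X i (idx2 hN)) \in Lfun P 1.
    apply: Lfun_subset12 => //; apply: sqr_integral_lty_Lfun2.
      exact: measurableT_comp.
    by rewrite (F2 i) ltry.
  have hL1 : (fun w => h x (X i (idx1 hN) w) (X i (idx2 hN) w)) \in Lfun P 1.
    rewrite [X in X \in _](_ : _ =
      (F i \o mpair (X i (idx1 hN)) (X i (idx2 hN)))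
      \+ cst (theta_row hN X h i x)).
      by apply: rpredD => //; exact: Lfun_cst.
    by apply/funext => w /=; rewrite subrK.
  have hE : ('E_P[fun w => h x (X i (idx1 hN) w) (X i (idx2 hN) w)] =
             (theta_row hN X h i x)%:E)%E.
    by rewrite /theta_row fineK// expectation_fin_num.
  have := expectationB hL1 (Lfun_cst P (theta_row hN X h i x) 1).
  by rewrite expectation_cst hE subee// => <-; rewrite [in RHS]unlock.
have mS : measurable_fun setT (fun w => \sum_(i < n) \sum_(j < N)
    \sum_(k < N | j != k) F i (X i j w, X i k w)).
  apply: measurable_sum => i; apply: measurable_sum => j.
  under eq_fun do rewrite big_mkcond.
  apply: measurable_sum => k; case: (j != k) => //.
  exact: (measurableT_comp (mF i) (measurable_mpair (X i j) (X i k))).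
under eq_integral do rewrite (Hstat_sub_theta hn) exprMn EFinM.
rewrite ge0_integralZl_EFin ?sqr_ge0//; first last.
- by apply/measurable_EFinP; exact: measurable_funX.
- by move=> w _; rewrite lee_fin sqr_ge0.
- rewrite (_ : (\sum_(i < n) v i = (\sum_(i < n) fine (v i))%:E)%E); last first.
    by rewrite -sumEFin; apply: eq_bigr => i _; rewrite fineK.
  have bound := centered_ustatistic_sqr_le X_rows X_iid F2 F0.
  rewrite (le_trans (lee_wpmul2l _ bound)) ?lee_fin ?sqr_ge0//.
  rewrite le_eqVlt; apply/orP; left; apply/eqP.
  by field; rewrite !gt_eqF.
Qed.

(** * Measurability in x and integration over x *)

(** Tonelli gives measurability in [x] for the integrals of the positive and negative parts. Their
    extended-real difference is then measurable, and so is its image under [fine]. *)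
Lemma measurable_theta_row (d : measure_display) (T : measurableType d)
    (R : realType) (P : probability T R) (n N : nat) (hN : (1 < N)%N)
    (X : 'I_n -> 'I_N -> {RV P >-> R}) (h : R -> R -> R -> R) (i : 'I_n) :
    measurable_fun [set: R * R * R] (fun p : R * R * R => h p.1.1 p.1.2 p.2) ->
  measurable_fun setT (theta_row hN X h i).
Proof.
move=> mh.
pose f (p : R * T) := (h p.1 (X i (idx1 hN) p.2) (X i (idx2 hN) p.2))%:E.
have mf : measurable_fun setT f.
  apply/measurable_EFinP.
  apply: (measurableT_comp mh (g := fun p : R * T =>
    (p.1, X i (idx1 hN) p.2, X i (idx2 hN) p.2))).
  by do 2 ?apply: measurable_fun_pair => //; exact: measurableT_comp.
rewrite /theta_row unlock.
apply: (measurableT_comp (f := fine)) => //.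
under eq_fun do rewrite integralE.
apply: emeasurable_funB.
  under eq_fun => x do rewrite (funepos_comp f (pair x)).
  apply: (measurable_fun_fubini_tonelli_F (m2 := P) f^\+%E) => //.
  exact: measurable_funepos.
under eq_fun => x do rewrite (funeneg_comp f (pair x)).
apply: (measurable_fun_fubini_tonelli_F (m2 := P) f^\-%E) => //.
exact: measurable_funeneg.
Qed.

Theorem lemma8 (d : measure_display) (T : measurableType d) (R : realType)
  (P : probability T R) (n N : nat) (hn : (0 < n)%N) (hN : (1 < N)%N)
  (X : 'I_n -> 'I_N -> {RV P >-> R})
  (X_rows : independent_rows X)
  (X_iid : forall i : 'I_n, iid (X i))
  (h : R -> R -> R -> R)
  (h_meas : measurable_fun [set: R * R * R]
              (fun p : R * R * R => h p.1.1 p.1.2 p.2))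
  (b : 'I_n -> R) (b_gt0 : forall i : 'I_n, 0 < b i)
  (h_bound : forall i : 'I_n,
    (\int[P]_w \int[lebesgue_measure]_x
       ((h x (X i (idx1 hN) w) (X i (idx2 hN) w)) ^+ 2)%:E
     <= (b i ^+ 2)%:E)%E) :
  let b2 : R := n%:R^-1 * \sum_(i < n) b i ^+ 2 in
  (\int[P]_w \int[lebesgue_measure]_x
     ((Hstat X h x w - theta hN X h x) ^+ 2)%:E
   <= (4 / (n%:R * N%:R))%:E * (sigma2 hN X h + b2%:E))%E.
Proof.
rewrite /=; set b2 := (X in (_ + X%:E)%E).
have b2_ge0 : 0 <= b2.
  by rewrite /b2 mulr_ge0 ?invr_ge0// sumr_ge0// => i _; exact: sqr_ge0.
have mth i : measurable_fun setT (theta_row hN X h i).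
  exact: measurable_theta_row.
have mhX i j k :
    measurable_fun setT (fun p : T * R => h p.2 (X i j p.1) (X i k p.1)).
  apply: (measurableT_comp h_meas (g := fun p : T * R =>
    (p.2, X i j p.1, X i k p.1))).
  by do 2 ?apply: measurable_fun_pair => //; exact: measurableT_comp.
have mdev i j k : measurable_fun setT (fun p : T * R =>
    h p.2 (X i j p.1) (X i k p.1) - theta_row hN X h i p.2).
  by apply: measurable_funB => //; exact: measurableT_comp.
have mH : measurable_fun setT
    (fun p : T * R => ((Hstat X h p.2 p.1 - theta hN X h p.2) ^+ 2)%:E).
  apply/measurable_EFinP; apply: measurable_funX.
  (* The centred form reduces joint measurability to that of each deviation, given by [mdev]. *)
  under eq_fun do rewrite (Hstat_sub_theta hn).
  apply: measurable_funM => //.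
  apply: measurable_sum => i; apply: measurable_sum => j.
  under eq_fun do rewrite big_mkcond.
  by apply: measurable_sum => k; case: (j != k).
have mv i : measurable_fun setT (fun p : T * R =>
    ((h p.2 (X i (idx1 hN) p.1) (X i (idx2 hN) p.1)
      - theta_row hN X h i p.2) ^+ 2)%:E).
  by apply/measurable_EFinP; exact: measurable_funX.
have sq_ge0 (r : R) : (0 <= (r ^+ 2)%:E)%E by rewrite lee_fin sqr_ge0.
have hx_meas x : measurable_fun [set: R * R] (fun u : R * R => h x u.1 u.2).
  apply: (measurableT_comp h_meas (g := fun u : R * R => (x, u.1, u.2))).
  by do 2 ?apply: measurable_fun_pair.
have c_ge0 : 0 <= 4 / (n%:R * N%:R) :> R by rewrite divr_ge0 ?mulr_ge0.
have n_ge0 : 0 <= n%:R^-1 :> R by rewrite invr_ge0.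
(* As [b2] is nonnegative, it suffices to bound the left-hand side by the [sigma2] term. *)
apply: (@le_trans _ _ ((4 / (n%:R * N%:R))%:E * sigma2 hN X h)%E); last first.
  by apply: lee_wpmul2l; rewrite ?lee_fin// leeDl// lee_fin.
pose v i x := (\int[P]_w ((h x (X i (idx1 hN) w) (X i (idx2 hN) w)
                 - theta_row hN X h i x) ^+ 2)%:E)%E.
have mvx i : measurable_fun setT (v i).
  exact: (measurable_fun_fubini_tonelli_G (m1 := P) _ (mv i)).
have v_ge0 i x : (0 <= v i x)%E by exact: integral_ge0.
(* Tonelli makes [x] the outer variable on both sides. The finite sum and the constants then move
   inside the integral over [x], leaving a pointwise comparison. *)
rewrite (fubini_tonelli (m1 := P) (m2 := lebesgue_measure) _ mH)//= /sigma2.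
rewrite (eq_bigr (fun i => \int[lebesgue_measure]_x v i x)%E); last first.
  move=> i _.
  by rewrite (fubini_tonelli (m1 := P) (m2 := lebesgue_measure) _ (mv i)).
rewrite -ge0_integral_sum//= -ge0_integralZl_EFin//=; last 2 first.
- by move=> x _; exact: sume_ge0.
- exact: emeasurable_sum.
rewrite -ge0_integralZl_EFin//=; last 2 first.
- by move=> x _; rewrite mule_ge0 ?lee_fin//; exact: sume_ge0.
- by apply: measurable_funeM; exact: emeasurable_sum.
apply: ge0_le_integral => //.
- by move=> x _; exact: integral_ge0.
- exact: (measurable_fun_fubini_tonelli_G (m1 := P) _ mH).
- by do 2 apply: measurable_funeM; exact: emeasurable_sum.
- by move=> x _; exact: integral_Hstat_sub_theta_sqr_le.
Qed.
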